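(* Let $M$ be a quasi-projective Gelfand left $R$-module and let $N\leq M$ be a submodule. Then $M/N$ is a Gelfand module.
   Context: $R$ is an associative ring with identity; modules are unital left $R$-modules. A submodule $N\leq M$ is fully invariant if $f(N)\subseteq N$ for all $f\in\mathrm{End}_R(M)$; $\Lambda^{fi}(M)$ is the lattice of fully invariant submodules of $M$, and $Max(M)$ is the set of maximal submodules of $M$. $M$ is quasi-projective if for every epimorphism $\rho\colon M\to X$ and every homomorphism $\alpha\colon M\to X$ there is $\beta\colon M\to M$ with $\rho\beta=\alpha$. For $N,L\leq M$ put $N_ML=\sum\{f(N)\mid f\in\mathrm{Hom}_R(M,L)\}$. A module $M$ is Gelfand if for every two distinct $N,L\in Max(M)$ there exist $N',L'\in\Lambda^{fi}(M)$ with $L'\nleq L$, $N'\nleq N$ and $L'_MN'=0$. *)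

(* Defs.v *)
From HB Require Import structures.
From mathcomp Require Import all_boot all_order all_algebra.
From mathcomp Require Import boolp.

Set Implicit Arguments.
Unset Strict Implicit.
Unset Printing Implicit Defensive.

Import GRing.Theory.

Local Open Scope ring_scope.
Local Open Scope quotient_scope.

(* Submodules of M are the terms of type [submodClosed M]. Their membership   *)
(* predicates are boolean, which is no restriction: by boolp every            *)
(* proposition is reflected by a boolean.                                     *)

(* A submodule L of M, as a left R-module. *)
Section Submodule.
Variables (R : pzRingType) (M : lmodType R) (L : submodClosed M).

Record submod_of := Submod {
  submod_val : M;
  submod_valP : submod_val \in L
}.

HB.instance Definition _ := [isSub for submod_val].
HB.instance Definition _ := [Choice of submod_of by <:].
HB.instance Definition _ := [SubChoice_isSubLmodule of submod_of by <:].

End Submodule.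

(* The quotient module M/N: the library's quotient of abelian groups          *)
(* [Quotient.quot], equipped with the scaling a (x + N) = a x + N.          *)
Section QuotientModule.
Variables (R : pzRingType) (M : lmodType R) (N : submodClosed M).

Definition submod_pred : {pred M} := N.

Fact submod_pred_zmod_closed : zmod_closed submod_pred.
Proof. exact: GRing.submod_closedB (submodClosedP N). Qed.

HB.instance Definition _ :=
  GRing.isZmodClosed.Build M submod_pred submod_pred_zmod_closed.

Definition quotmod : Type := Quotient.quot submod_pred.

HB.instance Definition _ := GRing.Zmodule.on quotmod.
HB.instance Definition _ := EqQuotient.on quotmod.
HB.instance Definition _ :=
  @isZmodQuotient.Build M (Quotient.equiv submod_pred) 0 -%R +%R quotmod
    (@pi_zeror _ _ _ _ _ (Quotient.quot submod_pred))
    (@pi_oppr _ _ _ _ _ (Quotient.quot submod_pred))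
    (@pi_addr _ _ _ _ _ (Quotient.quot submod_pred)).

Definition quotmod_scale (a : R) (x : quotmod) : quotmod :=
  \pi_quotmod (a *: repr x).

Lemma pi_quotmod_scale a x :
  quotmod_scale a (\pi_quotmod x) = \pi_quotmod (a *: x).
Proof.
have : repr (\pi_quotmod x) - x \in submod_pred.
  by rewrite Quotient.idealrBE; apply/eqP; exact: reprK.
move=> /(rpredZ a : forall u, u \in N -> _); rewrite scalerBr => aN.
by apply/eqP; rewrite -(Quotient.idealrBE submod_pred).
Qed.

Lemma quotmod_scaleA a b x :
  quotmod_scale a (quotmod_scale b x) = quotmod_scale (a * b) x.
Proof. by rewrite -[x]reprK (pi_quotmod_scale b) !pi_quotmod_scale scalerA. Qed.

Lemma quotmod_scale1 : left_id 1 quotmod_scale.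
Proof. by move=> x; rewrite -[x]reprK pi_quotmod_scale scale1r. Qed.

Lemma quotmod_scaleDr : right_distributive quotmod_scale +%R.
Proof.
move=> a x y; rewrite -[x]reprK -[y]reprK -raddfD !pi_quotmod_scale.
by rewrite scalerDr raddfD.
Qed.

Lemma quotmod_scaleDl x : {morph quotmod_scale^~ x : a b / a + b}.
Proof.
by move=> a b; rewrite -[x]reprK !pi_quotmod_scale scalerDl raddfD.
Qed.

HB.instance Definition _ := GRing.Zmodule_isLmodule.Build R quotmod
  quotmod_scaleA quotmod_scale1 quotmod_scaleDr quotmod_scaleDl.

Lemma pi_quotmod_is_scalable : scalable (\pi_quotmod : M -> quotmod).
Proof. by move=> a x; rewrite -pi_quotmod_scale. Qed.

HB.instance Definition _ :=
  GRing.isScalable.Build R M quotmod *:%R \pi_quotmod pi_quotmod_is_scalable.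

End QuotientModule.

Section Gelfand.
Variable R : pzRingType.
Implicit Type M : lmodType R.

Definition quasi_projective M : Prop :=
  forall (X : lmodType R) (rho alpha : {linear M -> X}),
    (forall y : X, exists x : M, rho x = y) ->
    exists beta : {linear M -> M}, rho \o beta =1 alpha.

Definition fully_invariant M (N : submodClosed M) : Prop :=
  forall (f : {linear M -> M}) (x : M), x \in N -> f x \in N.

Definition maximal_submod M (N : submodClosed M) : Prop :=
  ~ (N =i predT) /\
  forall K : submodClosed M, {subset N <= K} -> K =i N \/ K =i predT.

(* The sum over f in Hom(M, L) of the f(N), i.e. the finite sums of elements  *)
(* of the various f(N), viewed inside M.                                      *)
Definition submod_prod M (N L : submodClosed M) : {pred M} :=
  fun y => `[< exists (n : nat) (f : 'I_n -> {linear M -> submod_of L})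
                      (x : 'I_n -> M),
                 (forall i, x i \in N) /\
                 y = \sum_(i < n) submod_val (f i (x i)) >].

Definition gelfand M : Prop :=
  forall N L : submodClosed M,
    maximal_submod N -> maximal_submod L -> ~ (N =i L) ->
    exists N' L' : submodClosed M,
      [/\ fully_invariant N', fully_invariant L',
          ~ {subset L' <= L}, ~ {subset N' <= N} &
          submod_prod L' N' =i pred1 0].

End Gelfand.

(* Main.v *)
Require Import Defs.
From HB Require Import structures.
From mathcomp Require Import all_boot all_order all_algebra.
From mathcomp Require Import boolp.

(** The Gelfand property passes to every epimorphic image [p : M -> X] of a
    quasi-projective module, and [M/N] is such an image.

    Maximal submodules of [X] pull back along [p] to maximal submodules of [M],
    and distinct ones have distinct preimages ([maximal_preim],
    [eq_preim_submod]).  The Gelfand property of [M] then provides fully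
    invariant [N'], [L'] separating the preimages, and the submodules of [X]
    to take are the images [p(N')] and [p(L')].

    Quasi-projectivity makes this work twice.  An endomorphism [f] of [X] lifts
    along [p] to an endomorphism of [M], which preserves [N']; hence [p(N')] is
    fully invariant ([fully_invariant_im]).  And a homomorphism
    [g : X -> p(N')] has to kill [p(L')]: the composite [g \o p] maps [M] into
    [p(N')], and it lifts to a homomorphism [M -> N'] because a quasi-projective
    module is projective relative to its own submodules
    ([quasi_projective_lift_submod]); the lift kills [L'] since
    [L'_M N' = 0]. *)

Set Implicit Arguments.
Unset Strict Implicit.
Unset Printing Implicit Defensive.

Import GRing.Theory.

Local Open Scope ring_scope.
Local Open Scope quotient_scope.

Section Submodules.
Variables (R : pzRingType) (M X : lmodType R).

Definition submod_of_closed (P : {pred M}) (Pcl : submod_closed P) :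
    submodClosed M :=
  HB.pack P (GRing.isSubmodClosed.Build R M P Pcl).

Definition linear_of (f : M -> X) (flin : linear f) : {linear M -> X} :=
  HB.pack f (GRing.isLinear.Build R M X *:%R f flin).

Lemma submodB (L : submodClosed M) x y : x \in L -> y \in L -> x - y \in L.
Proof. exact: (GRing.submod_closedB (submodClosedP L)).2. Qed.

End Submodules.

Section ImagesAndPreimages.
Variables (R : pzRingType) (M X : lmodType R) (p : {linear M -> X}).

Fact preim_submod_closed (K : submodClosed X) :
  submod_closed [pred x : M | p x \in K].
Proof.
split; first by rewrite inE linear0 rpred0.
by move=> a x y; rewrite !inE linearP => xK yK; rewrite rpredD ?rpredZ.
Qed.

Definition preim_submod K := submod_of_closed (preim_submod_closed K).

Fact im_submod_closed (L : submodClosed M) :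
  submod_closed [pred y : X | `[< exists2 x, x \in L & p x = y >]].
Proof.
split; first by apply/asboolP; exists 0; rewrite ?rpred0 ?linear0.
move=> a _ _ /asboolP[x xL <-] /asboolP[y yL <-].
by apply/asboolP; exists (a *: x + y); rewrite ?linearP ?rpredD ?rpredZ.
Qed.

Definition im_submod L := submod_of_closed (im_submod_closed L).

Fact ker_in_submod_closed (L : submodClosed M) :
  submod_closed [pred x : M | (x \in L) && (p x == 0)].
Proof.
split; first by rewrite inE rpred0 linear0 eqxx.
move=> a x y; rewrite !inE linearP => /andP[xL /eqP->] /andP[yL /eqP->].
by rewrite rpredD ?rpredZ // scaler0 addr0 eqxx.
Qed.

Definition ker_in_submod L := submod_of_closed (ker_in_submod_closed L).

Lemma mem_ker_in_submod (L : submodClosed M) x :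
  (x \in ker_in_submod L) = (x \in L) && (p x == 0).
Proof. by []. Qed.

Lemma im_submodP (L : submodClosed M) y :
  reflect (exists2 x, x \in L & p x = y) (y \in im_submod L).
Proof. exact: asboolP. Qed.

Lemma mem_im_submod (L : submodClosed M) x : x \in L -> p x \in im_submod L.
Proof. by move=> xL; apply/im_submodP; exists x. Qed.

Hypothesis p_surj : forall y, exists x, p x = y.

Lemma eq_preim_submod (K L : submodClosed X) :
  preim_submod K =i preim_submod L -> K =i L.
Proof. by move=> eqKL y; have [x <-] := p_surj y; exact: eqKL x. Qed.

(** A submodule [P] containing [p^-1(K)] contains the kernel of [p], so that it
    is the preimage of its image, and the image is constrained by the
    maximality of [K]. *)
Lemma maximal_preim (K : submodClosed X) :
  maximal_submod K -> maximal_submod (preim_submod K).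
Proof.
move=> [Kproper Kmax]; split.
  by move=> KT; apply: Kproper => y; have [x <-] := p_surj y; exact: KT x.
move=> P subKP.
have sub_im : {subset K <= im_submod P}.
  move=> y; have [x <-] := p_surj y => xK.
  by apply: mem_im_submod; exact: subKP.
have preim_im x : (x \in P) = (p x \in im_submod P).
  apply/idP/im_submodP => [xP | [z zP pzx]]; first by exists x.
  rewrite -[x](subrK z) rpredD //; apply: subKP.
  by rewrite inE/= linearB pzx subrr rpred0.
by case: (Kmax _ sub_im) => eqP_; [left | right] => x; rewrite preim_im eqP_.
Qed.

End ImagesAndPreimages.

Lemma eq_pi_quotmod (R : pzRingType) (M : lmodType R) (N : submodClosed M)
  (x y : M) :
  (\pi_(quotmod N) x == \pi_(quotmod N) y) = (x - y \in N).
Proof. by rewrite -(Quotient.idealrBE (submod_pred N)). Qed.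

Lemma submod_prod_eq0P (R : pzRingType) (M : lmodType R)
    (N L : submodClosed M) :
  submod_prod N L =i pred1 0 <->
  forall (f : {linear M -> submod_of L}) x, x \in N -> submod_val (f x) = 0.
Proof.
split=> [NL0 f x xN | NL0 y].
  apply/eqP; rewrite -[_ == 0]NL0; apply/asboolP.
  by exists 1, (fun=> f), (fun=> x); rewrite big_ord1.
apply/asboolP/eqP => [[n [f [x [xN ->]]]] | ->].
  by rewrite big1 // => i _; exact: NL0.
by exists 0, (fun=> \0), (fun=> 0); split=> [[]|] //; rewrite big_ord0.
Qed.

Section QuasiProjective.
Variables (R : pzRingType) (M X : lmodType R) (p : {linear M -> X}).
Hypothesis M_qproj : quasi_projective M.

(** A quasi-projective module is projective relative to each of its submodules
    [K].  With [K0] the kernel of [p] on [K], the isomorphism of [p(K)] with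
    [K/K0] turns [alpha] into a map from [M] to [M/K0], where the lifting
    property of [M] applies; the lift lands in [K], the preimage of [K/K0]. *)
Lemma quasi_projective_lift_submod (K : submodClosed M)
    (alpha : {linear M -> X}) :
  (forall x, alpha x \in im_submod p K) ->
  exists beta : {linear M -> submod_of K},
    forall x, p (submod_val (beta x)) = alpha x.
Proof.
move=> alphaK; pose K0 := ker_in_submod p K.
have /choice[s sP] x : exists z, z \in K /\ p z = alpha x.
  by have /im_submodP[z] := alphaK x; exists z.
pose gamma x := \pi_(quotmod K0) (s x).
have gamma_lin : linear gamma.
  move=> a x y; rewrite /gamma -linearP; apply/eqP; rewrite eq_pi_quotmod.
  have [[sxK psx] [syK psy]] := (sP x, sP y).
  have [szK psz] := sP (a *: x + y).
  rewrite mem_ker_in_submod; apply/andP; split.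
    by rewrite submodB ?rpredD ?rpredZ.
  by rewrite linearB linearP psx psy psz linearP subrr.
have pi_surj (y : quotmod K0) : exists x, \pi_(quotmod K0) x = y.
  by exists (repr y); rewrite reprK.
have [beta betaP] := M_qproj (linear_of gamma_lin) pi_surj.
have beta_s x : beta x - s x \in K0.
  by rewrite -eq_pi_quotmod; apply/eqP; exact: betaP.
have betaK x : beta x \in K.
  have := beta_s x; rewrite mem_ker_in_submod => /andP[bsK _].
  by rewrite -[beta x](subrK (s x)) rpredD //; case: (sP x).
have beta_lin : linear (fun x => Submod (betaK x)).
  by move=> a x y; apply: val_inj; rewrite /= linearP.
exists (linear_of beta_lin) => x /=.
have := beta_s x.
rewrite mem_ker_in_submod linearB subr_eq0 => /andP[_ /eqP->].
by case: (sP x).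
Qed.

Hypothesis p_surj : forall y, exists x, p x = y.

Lemma fully_invariant_im (L : submodClosed M) :
  fully_invariant L -> fully_invariant (im_submod p L).
Proof.
move=> Linv f _ /im_submodP[x xL <-].
have [beta betaP] := M_qproj (f \o p) p_surj.
by rewrite -[f (p x)]betaP; apply/mem_im_submod/Linv.
Qed.

Lemma submod_prod_im_eq0 (N L : submodClosed M) :
  submod_prod N L =i pred1 0 ->
  submod_prod (im_submod p N) (im_submod p L) =i pred1 0.
Proof.
move=> /submod_prod_eq0P NL0.
apply/submod_prod_eq0P => g _ /im_submodP[x xN <-].
have gp_lin : linear (fun z => submod_val (g (p z))).
  by move=> a y z; rewrite !linearP.
have [z|beta betaP] :=
  quasi_projective_lift_submod (K := L) (alpha := linear_of gp_lin).
  exact: submod_valP.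
by rewrite -[LHS]betaP NL0 // linear0.
Qed.

Lemma gelfand_surj : gelfand M -> gelfand X.
Proof.
move=> M_gelfand K1 K2 K1max K2max neqK.
have [] := M_gelfand _ _ (maximal_preim p_surj K1max)
                         (maximal_preim p_surj K2max).
  by move=> /(eq_preim_submod p_surj).
move=> N' [L' [N'inv L'inv L'K2 N'K1 L'N'0]].
exists (im_submod p N'), (im_submod p L'); split.
- exact: fully_invariant_im.
- exact: fully_invariant_im.
- by move=> sub; apply: L'K2 => x xL'; exact/sub/mem_im_submod.
- by move=> sub; apply: N'K1 => x xN'; exact/sub/mem_im_submod.
- exact: submod_prod_im_eq0.
Qed.

End QuasiProjective.

Theorem proposition5p11 (R : pzRingType) (M : lmodType R) (N : submodClosed M) :
  quasi_projective M -> gelfand M -> gelfand (quotmod N).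
Proof.
move=> M_qproj; apply: (gelfand_surj (p := \pi_(quotmod N))) => // y.
by exists (repr y); exact: reprK.
Qed.
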